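(* Let $q_1,q_2,Y_1,Y_2,\rho>0$ and let the initial prices $p_{1,0},p_{2,0}>0$ be such that $(Y_1,Y_2)$ lies in zone III, i.e. $\frac{Y_1}{q_1}\ge p_{1,0}$ and $\frac{Y_2}{q_2}\ge p_{2,0}$. Then the unique Nash equilibrium (NE) at prices $(p_{1,0},p_{2,0})$ is $(\alpha,\beta,\gamma,\delta)=(q_1,0,0,q_2)$, and after at most one (upward) price adjustment the equilibrium point $E(p_{1,1}q_1,p_{2,1}q_2)$ is reached; that is, $p_{i,t}=p_{i,1}=Y_i/q_i$ for $i=1,2$ and all $t\ge 1$, with $p_{i,1}\ge p_{i,0}$, and these prices form a point of equilibrium (p.e.).
   Context: Model. Fix $q_1,q_2>0$ (quantities supplied each period in regions I and II), $Y_1,Y_2>0$ (per-period incomes of consumers I and II) and $\rho>0$ (transportation cost). For prices $p_1,p_2\ge 0$ write $p_i'=p_i+\rho$. In each period the following game is played. Consumer I chooses $(\alpha,\beta)\in S_1=\{\alpha,\beta\ge0,\ \alpha p_1+\beta p_2'\le Y_1\}$ (orders in regions I and II); consumer II chooses $(\gamma,\delta)\in S_2=\{\gamma,\delta\ge0,\ \gamma p_1'+\delta p_2\le Y_2\}$ (orders in regions I and II). Payoffs: $P_1=\min(\alpha,q_1)+\min(\beta,\max(0,q_2-\delta))$ and $P_2=\min(\delta,q_2)+\min(\gamma,\max(0,q_1-\alpha))$. Selected best replies. Given $(\gamma,\delta)$, consumer I's best reply is the maximizer of $P_1$ over $S_1$ that (SR1) among all maximizers minimizes the expenditure $p_1\alpha+p_2'\beta$,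 and (SR2) among those has the largest home order $\alpha$; (SR3) if $p_1=0$ the home order is instead set to $\alpha=q_1$. Given $(\alpha,\beta)$, consumer II's best reply is the maximizer of $P_2$ over $S_2$ that (SR1) minimizes $p_1'\gamma+p_2\delta$, and (SR2) among those has the largest home order $\delta$; (SR3) if $p_2=0$ the home order is set to $\delta=q_2$. A Nash equilibrium (NE) at prices $(p_1,p_2)$ is a quadruple $(\alpha,\beta,\gamma,\delta)$ in which each consumer's orders are the selected best reply to the other's. Price dynamics (discrete time). At time $t$, with prices $p_{1,t},p_{2,t}$ and corresponding NE $(\alpha,\beta,\gamma,\delta)$, put $q_1^{cons}=\alpha+\gamma$, $q_2^{cons}=\beta+\delta$, $Y_1^{res}=Y_1-p_{2,t}'\beta$, $Y_2^{res}=Y_2-p_{1,t}'\gamma$. If $q_i^{cons}<q_i$, then $p_{i,t+1}=p_{i,t}q_i^{cons}/q_i$ (downward adjustment); if $Y_i^{res}>p_{i,t}q_i$, then $p_{i,t+1}=Y_i^{res}/q_i$ (upward adjustment); otherwise $p_{i,t+1}=p_{i,t}$. A point of equilibrium (p.e.) for prices is a pair $(p_1,p_2)$ whose NE satisfies $\alpha+\gamma=q_1$, $\beta+\delta=q_2$, $p_1\alpha+p_2'\beta=Y_1$, $p_1'\gamma+p_2\delta=Y_2$; then prices remain unchanged. *)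

(* Defs.v *)
From mathcomp Require Import all_boot all_order all_algebra.
Set Implicit Arguments.
Unset Strict Implicit.
Unset Printing Implicit Defensive.
Import Order.TTheory GRing.Theory Num.Theory.
Local Open Scope ring_scope.

Record market (R : Type) := Market {
  q1 : R;   (* supply per period in region I *)
  q2 : R;   (* supply per period in region II *)
  Y1 : R;   (* income per period of consumer I *)
  Y2 : R;   (* income per period of consumer II *)
  rho : R   (* transportation cost *)
}.

(* The two consumers play mirror-image roles, so the reply of one consumer is
   described once, with
     ph, pf : unit price at home, and abroad (transportation included),
     Y      : income,
     qh     : home supply,
     rf     : foreign supply left over by the other consumer's home order,
     h, f   : home order, foreign order. *)

Definition payoff (R : realFieldType) (qh rf h f : R) : R :=
  Num.min h qh + Num.min f rf.

Definition feasible (R : realFieldType) (ph pf Y h f : R) : Prop :=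
  [/\ 0 <= h, 0 <= f & h * ph + f * pf <= Y].

Definition maximizer (R : realFieldType) (ph pf Y qh rf h f : R) : Prop :=
  feasible ph pf Y h f /\
  forall h' f', feasible ph pf Y h' f' ->
    payoff qh rf h' f' <= payoff qh rf h f.

Definition cheapest_maximizer (R : realFieldType)
    (ph pf Y qh rf h f : R) : Prop :=
  maximizer ph pf Y qh rf h f /\
  forall h' f', maximizer ph pf Y qh rf h' f' ->
    ph * h + pf * f <= ph * h' + pf * f'.

(* Ties are broken by the largest home order, except when the home price is 0:
   the home orders of the cheapest maximizers are then unbounded, and the home
   order is set to the home supply instead. *)
Definition selected_reply (R : realFieldType) (ph pf Y qh rf h f : R) : Prop :=
  cheapest_maximizer ph pf Y qh rf h f /\
  (if ph == 0 then h = qh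
   else forall h' f', cheapest_maximizer ph pf Y qh rf h' f' -> h' <= h).

Definition is_NE (R : realFieldType) (M : market R)
    (p1 p2 alpha beta gamma delta : R) : Prop :=
  selected_reply p1 (p2 + rho M) (Y1 M)
    (q1 M) (Num.max 0 (q2 M - delta)) alpha beta /\
  selected_reply p2 (p1 + rho M) (Y2 M)
    (q2 M) (Num.max 0 (q1 M - alpha)) delta gamma.

(* The downward and the upward conditions exclude each other at an NE, so the
   order of the two tests is immaterial there: if Yres > p * q, buying the whole
   home supply is affordable on top of the foreign order, hence a best reply
   exhausts it and qcons >= q. *)
Definition next_price (R : realFieldType) (p q qcons Yres : R) : R :=
  if qcons < q then p * qcons / q
  else if p * q < Yres then Yres / q
  else p.

Definition price_step (R : realFieldType) (M : market R)
    (p1 p2 p1' p2' : R) : Prop :=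
  exists alpha beta gamma delta : R,
    [/\ is_NE M p1 p2 alpha beta gamma delta,
        p1' = next_price p1 (q1 M) (alpha + gamma)
                (Y1 M - (p2 + rho M) * beta)
      & p2' = next_price p2 (q2 M) (beta + delta)
                (Y2 M - (p1 + rho M) * gamma)].

Definition price_trajectory (R : realFieldType) (M : market R)
    (p10 p20 : R) (p1 p2 : nat -> R) : Prop :=
  [/\ p1 0%N = p10, p2 0%N = p20
    & forall t : nat, price_step M (p1 t) (p2 t) (p1 t.+1) (p2 t.+1)].

Definition clears (R : realFieldType) (M : market R)
    (p1 p2 alpha beta gamma delta : R) : Prop :=
  [/\ alpha + gamma = q1 M, beta + delta = q2 M,
      p1 * alpha + (p2 + rho M) * beta = Y1 M
    & (p1 + rho M) * gamma + p2 * delta = Y2 M].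

(* Uniqueness of the NE is not presupposed: there is one, and all clear. *)
Definition point_of_equilibrium (R : realFieldType) (M : market R)
    (p1 p2 : R) : Prop :=
  (exists alpha beta gamma delta : R,
     is_NE M p1 p2 alpha beta gamma delta) /\
  (forall alpha beta gamma delta : R,
     is_NE M p1 p2 alpha beta gamma delta ->
     clears M p1 p2 alpha beta gamma delta).

(* Main.v *)
Require Import Defs.
From mathcomp Require Import all_boot all_order all_algebra.
From mathcomp Require Import lra.
Set Implicit Arguments.
Unset Strict Implicit.
Unset Printing Implicit Defensive.
Import Order.TTheory GRing.Theory Num.Theory.
Local Open Scope ring_scope.

(** Zone III says that each consumer can afford the whole home supply. Since
    transportation is costly ([rho > 0]), [p1 < p2 + rho] or [p2 < p1 + rho]:
    at least one consumer finds the home good strictly cheaper than the foreign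
    one, and then buys at least the whole home supply whatever the other does
    ([home_exhausted]). This leaves nothing abroad for the other consumer, for
    whom only home orders pay; the unique selected reply is then exactly the
    home supply and no foreign order ([selected_reply_no_foreign]). That in turn
    leaves nothing abroad for the first consumer, so that [(q1, 0, 0, q2)] is
    the only equilibrium ([zone3_NE]).

    At this equilibrium both supplies are sold and all income is available for
    home purchases, so one step moves the prices to [Y1 / q1] and [Y2 / q2]
    ([zone3_step]). These prices lie in zone III again, on its corner where
    [p * q = Y], so the same two lemmas show that they are stationary and that
    their equilibrium clears both markets and both budgets. *)

(** Spending on abroad only what remains after buying the whole home supply is
    a better plan than any with [h < qh]: income moved to the cheaper home good
    buys more than it gives up, and idle income is put to use. *)
Lemma home_exhausted (R : realFieldType) (ph pf Y qh rf h f : R) :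
    0 < ph -> ph < pf -> ph * qh <= Y -> 0 < qh -> 0 <= rf ->
  maximizer ph pf Y qh rf h f -> qh <= h.
Proof.
move=> hph hphf hY hq hrf [[h0 f0 hf] hmax].
have hpf : 0 < pf by lra.
have pf_neq0 : pf != 0 by rewrite gt_eqF.
rewrite leNgt; apply/negP => hlt.
pose g := (Y - ph * qh) / pf.
have g_cost : g * pf = Y - ph * qh by rewrite /g mulfVK.
have g0 : 0 <= g by rewrite /g divr_ge0 //; lra.
have : payoff qh rf qh g <= payoff qh rf h f.
  by apply: hmax; split=> //; [lra | rewrite g_cost; lra].
rewrite /payoff minxx (min_l (ltW hlt)).
have [hg|hg] := leP g rf; last first.
  have : Num.min f rf <= rf by rewrite ge_min lexx orbT.
  lra.
have minf : Num.min f rf <= f by rewrite ge_min lexx.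
(* The deviation [(qh, g)] spends all of [Y], so [(h, f)] costs at most as much. *)
have shift : pf * (f - g) <= ph * (qh - h) by lra.
have gain : ph * (qh - h) < pf * (qh - h) by rewrite ltr_pM2r //; lra.
have : f - g < qh - h by rewrite -(ltr_pM2l hpf); exact: le_lt_trans shift gain.
lra.
Qed.

Lemma payoff_no_foreign (R : realFieldType) (qh h f : R) :
  0 <= f -> payoff qh 0 h f = Num.min h qh.
Proof. by move=> f0; rewrite /payoff (min_r f0) addr0. Qed.

Lemma maximizer_no_foreign (R : realFieldType) (ph pf Y qh h f : R) :
    ph * qh <= Y -> 0 < qh ->
  maximizer ph pf Y qh 0 h f <-> feasible ph pf Y h f /\ qh <= h.
Proof.
move=> hY hq; split=> [[hfeas hmax]|[hfeas hle]]; split=> //.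
  have : payoff qh 0 qh 0 <= payoff qh 0 h f.
    by apply: hmax; split=> //; lra.
  have [_ f0 _] := hfeas.
  by rewrite !payoff_no_foreign // minxx le_min lexx andbT.
move=> h' f' [_ f'0 _]; have [_ f0 _] := hfeas.
by rewrite !payoff_no_foreign // (min_r hle) ge_min lexx orbT.
Qed.

(** With nothing left abroad, the maximizers are the feasible orders with
    [qh <= h]; as both prices are positive, cost increases strictly in both
    orders, so that [(qh, 0)] is the only cheapest one. *)
Lemma selected_reply_no_foreign (R : realFieldType) (ph pf Y qh h f : R) :
    0 < ph -> 0 < pf -> ph * qh <= Y -> 0 < qh ->
  selected_reply ph pf Y qh 0 h f <-> h = qh /\ f = 0.
Proof.
move=> hph hpf hY hq.
have best : maximizer ph pf Y qh 0 qh 0.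
  by apply/maximizer_no_foreign => //; split=> //; split=> //; lra.
have cheapestE h' f' : cheapest_maximizer ph pf Y qh 0 h' f' -> h' = qh /\ f' = 0.
  case=> /(maximizer_no_foreign _ _ _ hY hq) [[_ f0 _] hle] /(_ _ _ best) cost.
  have hh : 0 <= ph * (h' - qh) by apply: mulr_ge0; lra.
  have ff : 0 <= pf * f' by apply: mulr_ge0; lra.
  have /eqP : ph * (h' - qh) = 0 by lra.
  have /eqP : pf * f' = 0 by lra.
  rewrite !mulf_eq0 (gt_eqF hph) (gt_eqF hpf) /= subr_eq0.
  by move=> /eqP -> /eqP ->.
rewrite /selected_reply gt_eqF //; split=> [[/cheapestE]//|[-> ->]].
split; last by move=> h' f' /cheapestE [-> _].
split=> // h' f' /(maximizer_no_foreign _ _ _ hY hq) [[_ f0 _] hle].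
have hh : 0 <= ph * (h' - qh) by apply: mulr_ge0; lra.
have ff : 0 <= pf * f' by apply: mulr_ge0; lra.
lra.
Qed.

Lemma zone3_NE (R : realFieldType) (M : market R) (p1 p2 : R) :
    0 < q1 M -> 0 < q2 M -> 0 < rho M -> 0 < p1 -> 0 < p2 ->
    p1 * q1 M <= Y1 M -> p2 * q2 M <= Y2 M ->
  forall alpha beta gamma delta : R,
    is_NE M p1 p2 alpha beta gamma delta <->
    [/\ alpha = q1 M, beta = 0, gamma = 0 & delta = q2 M].
Proof.
move=> hq1 hq2 hrho hp1 hp2 hY1 hY2 a b c d.
have hp1' : 0 < p1 + rho M by lra.
have hp2' : 0 < p2 + rho M by lra.
have left_ge0 (x : R) : 0 <= Num.max 0 x by rewrite le_max lexx.
have left0 (q x : R) : q <= x -> Num.max 0 (q - x) = 0.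
  by move=> le_qx; apply/max_l; rewrite subr_le0.
have reply1E h f := selected_reply_no_foreign h f hp1 hp2' hY1 hq1.
have reply2E h f := selected_reply_no_foreign h f hp2 hp1' hY2 hq2.
split; last first.
  case=> -> -> -> ->; rewrite /is_NE !left0 //.
  by split; [exact/reply1E | exact/reply2E].
case=> reply1 reply2.
have [lt1|ge1] := ltP p1 (p2 + rho M).
  have full1 : q1 M <= a.
    by case: reply1 => -[best _] _; exact: (home_exhausted _ _ _ _ _ best).
  move: reply2; rewrite left0 // => /reply2E [dE cE].
  by move: reply1; rewrite dE left0 // => /reply1E [aE bE].
(* As [rho > 0], [ge1] gives [p2 < p1 + rho]: home is cheaper for consumer II. *)
have full2 : q2 M <= d.
  by case: reply2 => -[best _] _; apply: (home_exhausted _ _ _ _ _ best) => //; lra.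
move: reply1; rewrite left0 // => /reply1E [aE bE].
by move: reply2; rewrite aE left0 // => /reply2E [dE cE].
Qed.

Lemma zone3_step (R : realFieldType) (M : market R) (p1 p2 p1' p2' : R) :
    0 < q1 M -> 0 < q2 M -> 0 < rho M -> 0 < p1 -> 0 < p2 ->
    p1 * q1 M <= Y1 M -> p2 * q2 M <= Y2 M ->
  price_step M p1 p2 p1' p2' <-> p1' = Y1 M / q1 M /\ p2' = Y2 M / q2 M.
Proof.
move=> hq1 hq2 hrho hp1 hp2 hY1 hY2.
have NE := zone3_NE hq1 hq2 hrho hp1 hp2 hY1 hY2.
(* When [p * q = Y] no test of [next_price] fires, but [p] is already [Y / q]. *)
have nextE (p q Y : R) : 0 < q -> p * q <= Y -> next_price p q q Y = Y / q.
  move=> hq; rewrite /next_price ltxx; case: ltgtP => // <- _.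
  by rewrite mulfK // gt_eqF.
split=> [[a [b [c [d [/NE [-> -> -> ->] -> ->]]]]]|[-> ->]].
  by rewrite addr0 add0r !mulr0 !subr0 !nextE.
exists (q1 M), 0, 0, (q2 M); split; first exact/NE.
  by rewrite addr0 mulr0 subr0 nextE.
by rewrite add0r mulr0 subr0 nextE.
Qed.

Theorem proposition4p2 (R : realFieldType) (M : market R) (p10 p20 : R)
    (hq1 : 0 < q1 M) (hq2 : 0 < q2 M) (hY1 : 0 < Y1 M) (hY2 : 0 < Y2 M)
    (hrho : 0 < rho M) (hp10 : 0 < p10) (hp20 : 0 < p20)
    (hIII1 : Y1 M / q1 M >= p10) (hIII2 : Y2 M / q2 M >= p20) :
  (forall alpha beta gamma delta : R,
     is_NE M p10 p20 alpha beta gamma delta <->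
     [/\ alpha = q1 M, beta = 0, gamma = 0 & delta = q2 M]) /\
  (exists p1 p2 : nat -> R, price_trajectory M p10 p20 p1 p2) /\
  (forall p1 p2 : nat -> R, price_trajectory M p10 p20 p1 p2 ->
     [/\ p1 1%N = Y1 M / q1 M /\ p2 1%N = Y2 M / q2 M,
         forall t : nat, (1 <= t)%N -> p1 t = p1 1%N /\ p2 t = p2 1%N,
         p10 <= p1 1%N /\ p20 <= p2 1%N
       & point_of_equilibrium M (p1 1%N) (p2 1%N)]).
Proof.
have zone1 : p10 * q1 M <= Y1 M by rewrite -ler_pdivlMr.
have zone2 : p20 * q2 M <= Y2 M by rewrite -ler_pdivlMr.
have eq1 : Y1 M / q1 M * q1 M = Y1 M by rewrite divfK // gt_eqF.
have eq2 : Y2 M / q2 M * q2 M = Y2 M by rewrite divfK // gt_eqF.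
have pos1 : 0 < Y1 M / q1 M by rewrite divr_gt0.
have pos2 : 0 < Y2 M / q2 M by rewrite divr_gt0.
have corner1 : Y1 M / q1 M * q1 M <= Y1 M by rewrite eq1.
have corner2 : Y2 M / q2 M * q2 M <= Y2 M by rewrite eq2.
have stepE p1' p2' :=
  zone3_step p1' p2' hq1 hq2 hrho hp10 hp20 zone1 zone2.
have fixE p1' p2' :=
  zone3_step p1' p2' hq1 hq2 hrho pos1 pos2 corner1 corner2.
split; first exact: zone3_NE.
split.
  exists (fun t => if t is 0%N then p10 else Y1 M / q1 M).
  exists (fun t => if t is 0%N then p20 else Y2 M / q2 M).
  by split=> // -[|t]; [exact/stepE | exact/fixE].
move=> p1 p2 [p1_0 p2_0 step].
have reached t : p1 t.+1 = Y1 M / q1 M /\ p2 t.+1 = Y2 M / q2 M.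
  elim: t => [|t [IH1 IH2]]; first by apply/stepE; rewrite -p1_0 -p2_0.
  by apply/fixE; have := step t.+1; rewrite IH1 IH2.
have [p1_1 p2_1] := reached 0%N.
split=> //.
- by case=> // t _; rewrite p1_1 p2_1; exact: reached.
- by rewrite p1_1 p2_1.
have NE := zone3_NE hq1 hq2 hrho pos1 pos2 corner1 corner2.
rewrite p1_1 p2_1; split.
  by exists (q1 M), 0, 0, (q2 M); apply/NE.
move=> a b c d /NE [-> -> -> ->].
by split; rewrite ?mulr0 ?addr0 ?add0r.
Qed.
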